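(* Let $X$ be a Banach space with norming $\ell_1$-structure witnessed by a set $A\subseteq S_{X^*}$. If $\pi(A)'\cap\pi(A)$ is an infinite set, then $X$ has the weak-DD2P.
   Context: Banach spaces are over $\mathbb{K}=\mathbb{R}$ or $\mathbb{C}$; $B_X$ and $S_X$ denote the closed unit ball and unit sphere of $X$, and $X^*$ is the topological dual. $X$ has a norming $\ell_1$-structure witnessed by $A\subseteq S_{X^*}$ if $A$ is one-norming for $X$ (i.e. $\|x\|=\sup_{a^*\in A}|a^*(x)|$ for all $x\in X$) and, for every $a^*\in A$, the line $\mathbb{K}a^*$ is an $L$-summand of $X^*$, that is, $X^*=\mathbb{K}a^*\oplus_1 Z$ for some subspace $Z\subseteq X^*$. On $S_{X^*}$ consider the equivalence relation $f\sim g$ if and only if $f$ and $g$ are linearly dependent; $S_{X^*}/\!\sim$ carries the quotient topology induced by the weak$^*$ topology of $S_{X^*}$ and $\pi\colon S_{X^*}\to S_{X^*}/\!\sim$ is the quotient map. For a subset $B$ of a topological space $V$, $B'$ denotes the set of cluster (accumulation) points of $B$ in $V$. $X$ has the weak-DD2P if for every non-empty relatively weakly open subset $W$ of $B_X$ there exists $x\in W$ such that $\sup_{y\in V}\|x-y\|=2$ for every relatively weakly open subset $V$ of $B_X$ with $x\in V$. *)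

(* Defs.v *)
From HB Require Import structures.
From mathcomp Require Import all_boot all_order all_algebra generic_quotient.
From mathcomp Require Import all_classical all_reals all_analysis.
From mathcomp Require Export complex.
Import Order.TTheory GRing.Theory Num.Theory.
Import numFieldTopology.Exports numFieldNormedType.Exports.

Set Implicit Arguments.
Unset Strict Implicit.
Unset Printing Implicit Defensive.

Local Open Scope classical_set_scope.
Local Open Scope ring_scope.
Local Open Scope quotient_scope.

(* Everything is parametrized by a scalar field [K : numFieldType], to be
   instantiated with a [realType] or with its complexification. Norms are
   [K]-valued; over the complex numbers they take their values among the
   nonnegative reals, and [supremum 0 E] is the least upper bound of [E] in
   the partially ordered field [K] whenever [E] is nonempty and has one. *)

Section Dual.
Context {K : numFieldType} (X : normedModType K).

Definition is_dual : {pred X -> K^o} :=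
  fun f => `[< linear f /\ continuous f >].

Record topdual := Dual { dual_fun :> X -> K^o ; _ : dual_fun \in is_dual }.

HB.instance Definition _ := [isSub for dual_fun].
HB.instance Definition _ := [Choice of topdual by <:].

Fact is_dual_submod_closed : submod_closed is_dual.
Proof.
split; first by apply/asboolP; split=> [a x y /=|x];
  [rewrite scaler0 addr0 | exact: cvg_cst].
move=> a f g /asboolP[fl fc] /asboolP[gl gc]; apply/asboolP; split.
  move=> b x y; change (a *: f (b *: x + y) + g (b *: x + y) =
    b *: (a *: f x + g x) + (a *: f y + g y)).
  by rewrite fl gl !scalerDr !scalerA (mulrC a b) addrACA.
by move=> x; apply: cvgD; [apply: cvgZl_tmp; exact: fc | exact: gc].
Qed.

HB.instance Definition _ :=
  GRing.isSubmodClosed.Build K (X -> K^o) is_dual is_dual_submod_closed.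
HB.instance Definition _ := [SubChoice_isSubLmodule of topdual by <:].

Definition unit_ball : set X := [set x | `|x| <= 1].

Definition dual_norm (f : topdual) : K :=
  supremum 0 [set `|f x| | x in unit_ball].

(* [X] with its weak topology: the coarsest one that makes every [f : topdual]
   continuous. *)
Definition weak_space : Type :=
  initial_topology
    (fun x : X => (fun f : topdual => f x) : {ptws topdual -> K^o}).
HB.instance Definition _ := Topological.on weak_space.

(* [topdual] with its weak* topology. *)
Definition weak_star_dual : Type :=
  initial_topology (fun f : topdual => (f : X -> K^o) : {ptws X -> K^o}).
HB.instance Definition _ := Topological.on weak_star_dual.

(* As a type, this set carries the topology induced by [weak_star_dual]. *)
Definition dual_sphere : set weak_star_dual := [set f | dual_norm f = 1].

Definition lin_dep (f g : topdual) : Prop :=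
  exists a b : K, (a != 0 \/ b != 0) /\ a *: f + b *: g = 0.

Definition sphere_equiv : rel (dual_sphere : Type) :=
  fun f g => `[< lin_dep (\val f) (\val g) >].

Fact dual_sphere_neq0 (f : dual_sphere) : (\val f : topdual) != 0.
Proof.
apply/eqP => f0; have := set_valP f; rewrite /dual_sphere /= => /eqP.
rewrite [X in dual_norm X]f0 /dual_norm.
rewrite (_ : [set _ | _ in _] = [set 0]) ?supremum1 1?eq_sym ?oner_eq0 //.
apply/seteqP; split=> [_ [x _ <-]|_ ->] /=; first by rewrite normr0.
by exists 0; rewrite /unit_ball /= ?normr0 // ler01.
Qed.

Fact sphere_equiv_is_equiv : equiv_class_of sphere_equiv.
Proof.
have sym f g : lin_dep f g -> lin_dep g f.
  by move=> [a [b [ab e]]]; exists b, a; split; [tauto | rewrite addrC].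
have neq0 (f g : topdual) a b : g != 0 -> a != 0 \/ b != 0 ->
    a *: f + b *: g = 0 -> a != 0.
  move=> g0 ab e; apply/eqP => a0; case: ab => [|b0]; first by rewrite a0 eqxx.
  by move/eqP: e; rewrite a0 scale0r add0r scaler_eq0 (negPf b0) (negPf g0).
split=> [f|f g|g f h].
- apply/asboolP; exists 1, (-1); split; first by left; rewrite oner_eq0.
  by rewrite scaleN1r scale1r subrr.
- by apply/asboolP/asboolP; apply: sym.
- move=> /asboolP[a [b [ab e1]]] /asboolP[c [d [cd e2]]].
  have a0 := neq0 _ _ _ _ (dual_sphere_neq0 g) ab e1.
  have c0 := neq0 _ _ _ _ (dual_sphere_neq0 h) cd e2.
  apply/asboolP; exists (c * a), (- (b * d)).
  split; first by left; rewrite mulf_neq0.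
  have : c *: (a *: (\val f : topdual) + b *: (\val g : topdual)) -
         b *: (c *: (\val g : topdual) + d *: (\val h : topdual)) = 0.
    by rewrite e1 e2 !scaler0 subrr.
  by rewrite !scalerDr !scalerA (mulrC c b) opprD addrA addrK scaleNr.
Qed.

Canonical sphere_equivRel := EquivRelPack sphere_equiv_is_equiv.

Definition sphere_quotient : Type :=
  quotient_topology {eq_quot sphere_equivRel}.
HB.instance Definition _ := Topological.on sphere_quotient.

Definition sphere_pi : dual_sphere -> sphere_quotient :=
  \pi_(quotient_topology {eq_quot sphere_equivRel}).

Definition linear_subspace (Y : set topdual) : Prop := submod_closed (mem Y).

Definition L_summand (Y : set topdual) : Prop :=
  exists Z : set topdual,
    [/\ linear_subspace Z, Y `&` Z = [set 0],
        forall f, exists y z, [/\ Y y, Z z & f = y + z] &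
        forall y z, Y y -> Z z -> dual_norm (y + z) = dual_norm y + dual_norm z].

Definition scalar_line (f : topdual) : set topdual :=
  [set c *: f | c in [set: K]].

Definition one_norming (A : set dual_sphere) : Prop :=
  forall x : X, `|x| = supremum 0 [set `|(\val f : topdual) x| | f in A].

Definition norming_l1_structure (A : set dual_sphere) : Prop :=
  one_norming A /\ forall f, A f -> L_summand (scalar_line (\val f)).

Definition rel_weakly_open (W : set X) : Prop :=
  exists2 U : set weak_space, open U & W = unit_ball `&` U.

Definition weak_DD2P : Prop :=
  forall W, rel_weakly_open W -> W !=set0 ->
  exists2 x, W x & forall V, rel_weakly_open V -> V x ->
    supremum 0 [set `|x - y| | y in V] = 2.

End Dual.

Arguments dual_sphere {K} X _.
Arguments unit_ball {K} X _.
Arguments sphere_pi {K X} _.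

(* Main.v *)
Require Import Defs.
From HB Require Import structures.
From mathcomp Require Import finmap.
From mathcomp Require Import all_boot all_order all_algebra.
From mathcomp Require Import all_classical all_reals all_analysis complex.
From mathcomp Require Import ring lra.
Import Order.TTheory GRing.Theory Num.Theory.
Import numFieldTopology.Exports numFieldNormedType.Exports.

Set Implicit Arguments.
Unset Strict Implicit.
Unset Printing Implicit Defensive.

Local Open Scope classical_set_scope.
Local Open Scope ring_scope.

(** Let a be in A, so that the dual of X is the l1-sum of the line K a and of
    some subspace Z, and let c f be the coordinate of a functional f along a.
    In the bidual the norm is then the maximum of the norms of the restrictions
    to K a and to Z, so a point x of the unit ball may have its value a(x)
    replaced by any scalar of modulus at most 1 without leaving the ball, and
    without moving any functional of Z. Hahn-Banach brings this back to X up to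
    an arbitrarily small error ([L_coordinate_perturbation]): there is w in X
    with a(w) prescribed, x + w almost in the ball, finitely many functionals
    of Z almost zero at w, and |w| almost as small as |a(w)|. Two consequences
    are used.

    - Large moves in the weak topology ([L_coordinate_prescribe]): for finitely
      many functionals f with |c f| small, some y in the ball has a(y) close to
      a given scalar of modulus at most 1, and all f(y) close to f(x).
    - Small moves in norm ([norm_attaining_near]): if |a(x)| is almost 1, then
      a point y of the ball close to x in norm has |a(y)| = 1. This is an
      iteration with geometrically decreasing steps.

    Smallness of |c f| comes for free: the coordinates along pairwise
    independent elements of A satisfy sum |c f| <= |f|, so for a given f only
    finitely many classes of A have a coordinate of modulus at least 1/4
    ([finite_large_coordinates]).

    Given a weakly open set W meeting the ball at x0, finitely many functionals
    describe a neighbourhood of x0 in W. Among the infinitely many classes in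
    the intersection of pi(A) with its cluster points, one has small
    coordinates on these functionals; let a represent it. A large move gives a
    point of W with a(x) almost 1, and a small move gives x in W with
    |a(x)| = 1. This x has the required property: for a weak neighbourhood V of
    x, the class of a is a cluster point of pi(A), hence some b in A has |b(x)|
    almost 1 and small coordinates on the functionals describing V. A large
    move along b then gives y in V with b(y) almost -b(x)/|b(x)|, so that
    |x - y| >= |b(x) - b(y)| is almost 2.

    The real and the complex case are treated at once: the scalar field is an
    arbitrary [numFieldType] that satisfies [sup_complete] and
    [hahn_banach_separation]. *)

(** * Sublinear functionals and the Hahn-Banach theorem over the reals *)

Section Sublinear.
Context {R : realType} {V : lmodType R}.
Implicit Types (p q : V -> R) (u v w : V).

Definition sublinear p :=
  (forall u v, p (u + v) <= p u + p v) /\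
  (forall t v, 0 <= t -> p (t *: v) = t * p v).

Lemma sublinear0 p : sublinear p -> p 0 = 0.
Proof. by case=> _ /(_ 0 0 (lexx _)); rewrite scale0r mul0r. Qed.

Lemma sublinear_ge p u v : sublinear p -> p u - p (- v) <= p (v + u).
Proof. by case=> pD _; rewrite lerBlDr (le_trans _ (pD _ _))// addrC addKr. Qed.

(** The pairs (u, s) of such a cone are the constraints s <= g u to be imposed
    on a linear minorant g of q; the last clause says that q allows them. *)
Definition weighted_cone q (P : set (V * R)) :=
  [/\ P (0, 0), forall x y, P x -> P y -> P (x + y),
      forall t x, 0 <= t -> P x -> P (t *: x.1, t * x.2) &
      forall x, P x -> x.2 <= q x.1].

(** Decreasing q to this functional forces the constraints of P
    ([cone_infN]): it is the largest sublinear minorant of q that does so. *)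
Definition cone_inf q (P : set (V * R)) v :=
  inf [set q (v + x.1) - x.2 | x in P].

Section ConeInf.
Variables (q : V -> R) (P : set (V * R)).
Hypotheses (qS : sublinear q) (PC : weighted_cone q P).

Lemma cone_inf_le v x : P x -> cone_inf q P v <= q (v + x.1) - x.2.
Proof.
case: PC => P0 PD PZ Pq Px; apply: ge_inf; last by exists x.
exists (- q (- v)) => _ [y Py <-].
by have := sublinear_ge y.1 v qS; have := Pq _ Py; lra.
Qed.

Lemma le_cone_inf v r :
  (forall x, P x -> r <= q (v + x.1) - x.2) -> r <= cone_inf q P v.
Proof.
case: PC => P0 _ _ _ h; apply: lb_le_inf; first by eexists; exists (0, 0).
by move=> _ [y Py <-]; exact: h.
Qed.

Lemma cone_inf_le_self v : cone_inf q P v <= q v.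
Proof.
case: PC => P0 _ _ _.
by have := cone_inf_le v P0; rewrite /= addr0 subr0.
Qed.

Lemma cone_infN x : P x -> cone_inf q P (- x.1) <= - x.2.
Proof.
move=> Px; have := cone_inf_le (- x.1) Px.
by rewrite addNr (sublinear0 qS) sub0r.
Qed.

Lemma sublinear_cone_inf : sublinear (cone_inf q P).
Proof.
case: (PC) => P0 PD PZ Pq; split=> [u v|].
  rewrite -lerBlDl; apply: le_cone_inf => x Px.
  rewrite lerBlDr -lerBlDl; apply: le_cone_inf => y Py.
  rewrite lerBlDr (le_trans (cone_inf_le _ (PD _ _ Py Px)))//=.
  case: qS => /(_ (u + y.1) (v + x.1)) qD _.
  by rewrite addrACA in qD; lra.
have le_hom t v : 0 < t -> t * cone_inf q P v <= cone_inf q P (t *: v).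
  move=> t0; apply: le_cone_inf => x Px.
  have ti0 : 0 <= t^-1 by rewrite invr_ge0 ltW.
  have := cone_inf_le v (PZ _ _ ti0 Px).
  rewrite -(ler_pM2l t0) /= => /le_trans; apply.
  rewrite mulrBr -(qS.2 _ _ (ltW t0)) scalerDr scalerA mulrA.
  by rewrite divff ?gt_eqF// scale1r mul1r.
move=> t v; rewrite le_eqVlt => /orP[/eqP <-|t0].
  rewrite scale0r mul0r; apply/eqP; rewrite eq_le; apply/andP; split.
    by have := cone_inf_le_self 0; rewrite (sublinear0 qS).
  by apply: le_cone_inf => x Px; rewrite add0r subr_ge0 Pq.
apply/eqP; rewrite eq_le le_hom// andbT.
have ti0 : 0 < t^-1 by rewrite invr_gt0.
have := le_hom _ (t *: v) ti0; rewrite scalerA mulVf ?gt_eqF// scale1r.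
by rewrite -(ler_pM2l t0) mulrA divff ?gt_eqF// mul1r.
Qed.

End ConeInf.

(** Zorn's lemma on sublinear functionals themselves, rather than on partially
    defined linear ones: the pointwise infimum of a chain is again sublinear. *)
Lemma minimal_sublinear p : sublinear p -> exists q, [/\ sublinear q,
  forall v, q v <= p v &
  forall q', sublinear q' -> (forall v, q' v <= q v) -> q' = q].
Proof.
move=> pS; pose T := {q : V -> R | sublinear q /\ forall v, q v <= p v}.
pose leT (q q' : T) := `[< forall v, sval q' v <= sval q v >].
have [||||[q [qS qp]] qmin] := @Zorn T leT.
- by move=> q; apply/asboolP => v.
- move=> a b c /asboolP ab /asboolP bc; apply/asboolP => v.
  exact: le_trans (bc v) (ab v).
- move=> [a Pa] [b Pb] /asboolP ab /asboolP ba; apply/eq_exist/funext => v.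
  by apply/eqP; rewrite eq_le ab ba.
- move=> A Atot; have [->|/set0P[q0 Aq0]] := eqVneq A set0.
    by exists (exist _ p (conj pS (fun=> lexx _))).
  pose m v := inf [set sval q v | q in A].
  have mle v (q : T) : A q -> m v <= sval q v.
    move=> Aq; apply: ge_inf; last by exists q.
    exists (- p (- v)) => _ [[q' [q'S q'p]] Aq' <-] /=.
    have := sublinear_ge 0 v q'S; rewrite addr0 (sublinear0 q'S).
    by have := q'p (- v); lra.
  have lem v r : (forall q : T, A q -> r <= sval q v) -> r <= m v.
    move=> h; apply: lb_le_inf; first by exists (sval q0 v), q0.
    by move=> _ [q Aq <-]; exact: h.
  have mS : sublinear m.
    split=> [u v|t v].
      rewrite -lerBlDl; apply: (lem) => q Aq; rewrite lerBlDr -lerBlDl.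
      apply: (lem) => q' Aq'; rewrite lerBlDr.
      have [/asboolP h|/asboolP h] := Atot _ _ Aq Aq'.
        apply: (le_trans (mle _ _ Aq')); apply: (le_trans ((svalP q').1.1 _ _)).
        by rewrite lerD2l.
      apply: (le_trans (mle _ _ Aq)); apply: (le_trans ((svalP q).1.1 _ _)).
      by rewrite lerD2r.
    rewrite le_eqVlt => /orP[/eqP <-|t0].
      rewrite scale0r mul0r; apply/eqP; rewrite eq_le; apply/andP; split.
        by have := mle 0 _ Aq0; rewrite (sublinear0 (svalP q0).1).
      by apply: (lem) => q Aq; rewrite (sublinear0 (svalP q).1).
    apply/eqP; rewrite eq_le; apply/andP; split.
      rewrite mulrC -ler_pdivrMr//; apply: (lem) => q Aq.
      rewrite ler_pdivrMr// mulrC -((svalP q).1.2 _ _ (ltW t0)); exact: mle.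
    apply: (lem) => q Aq; rewrite ((svalP q).1.2 _ _ (ltW t0)).
    by rewrite ler_pM2l// mle.
  have mp v : m v <= p v by exact: le_trans (mle _ _ Aq0) ((svalP q0).2 v).
  exists (exist _ m (conj mS mp)) => q Aq; apply/asboolP => v; exact: mle.
exists q; split=> // q' q'S q'q.
have q'p v : q' v <= p v by exact: le_trans (qp v).
have := qmin (exist _ q' (conj q'S q'p)).
have l : leT (exist _ q (conj qS qp)) (exist _ q' (conj q'S q'p)).
  by apply/asboolP => v; exact: q'q.
by move=> /(_ l)/(congr1 sval).
Qed.

(** A minimal sublinear q is linear: lowering q along the ray spanned by the
    constraint (v, q v) changes nothing, which gives q u + q v <= q (u + v). *)
Lemma minimal_sublinear_linear p : sublinear p ->
  exists2 g : V -> R, scalar g & forall v, g v <= p v.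
Proof.
move=> /minimal_sublinear[q [qS qp qmin]]; exists q => //.
have qD u v : q (u + v) = q u + q v.
  pose P : set (V * R) := [set x | exists2 t, 0 <= t & x = (t *: v, t * q v)].
  have PC : weighted_cone q P.
    split.
    - by exists 0; rewrite ?scale0r ?mul0r.
    - move=> _ _ [t t0 ->] [s s0 ->]; exists (t + s); rewrite ?addr_ge0//.
      by rewrite scalerDl mulrDl.
    - move=> t _ t0 [s s0 ->]; exists (t * s); rewrite ?mulr_ge0//=.
      by rewrite scalerA mulrA.
    - by move=> _ [t t0 ->] /=; rewrite qS.2.
  have eq := qmin _ (sublinear_cone_inf qS PC) (cone_inf_le_self qS PC).
  apply/eqP; rewrite eq_le qS.1 /= -lerBrDr.
  rewrite -[X in X <= _](congr1 (@^~ u) eq).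
  have Pv : P (v, q v) by exists 1; rewrite ?scale1r ?mul1r.
  exact: (cone_inf_le qS PC u Pv).
have qN v : q (- v) = - q v.
  by apply/eqP; rewrite -addr_eq0 -qD addNr (sublinear0 qS).
move=> t u v; rewrite qD; congr (_ + _).
have [t0|t0] := leP 0 t; first exact: qS.2.
rewrite -[t in LHS]opprK scaleNr qN qS.2 ?mulNr ?opprK// oppr_ge0 ltW//.
Qed.

(** The constraints g (t e + j) >= t r for t >= 0 and j in J say at once that
    g e >= r and that g vanishes on J, since J is symmetric. *)
Lemma hahn_banach_separation_real (N : V -> R) (J : set V) (e : V) (r : R) :
  sublinear N -> J 0 ->
  (forall t u v, J u -> J v -> J (t *: u + v)) ->
  0 <= r -> (forall j, J j -> r <= N (e - j)) ->
  exists g : V -> R, [/\ scalar g, forall v, g v <= N v,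
    forall j, J j -> g j = 0 & r <= g e].
Proof.
move=> NS J0 JL r0 rN.
pose P : set (V * R) :=
  [set x | exists t j, [/\ 0 <= t, J j & x = (t *: e + j, t * r)]].
have JZ t v : J v -> J (t *: v) by move=> Jv; rewrite -[_ *: _]addr0; apply: JL.
have JD u v : J u -> J v -> J (u + v).
  by move=> Ju Jv; rewrite -[u]scale1r; apply: JL.
have PC : weighted_cone N P.
  split.
  - by exists 0, 0; rewrite ?scale0r ?mul0r ?addr0.
  - move=> _ _ [t [j [t0 Jj ->]]] [s [k [s0 Jk ->]]].
    exists (t + s), (j + k); split; rewrite ?addr_ge0//; first exact: JD.
    by rewrite scalerDl addrACA mulrDl.
  - move=> s _ s0 [t [j [t0 Jj ->]]]; exists (s * t), (s *: j).
    by split; [rewrite mulr_ge0|exact: JZ|rewrite scalerDr scalerA mulrA].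
  - move=> _ [t [j [t0 Jj ->]]] /=; move: t0.
    rewrite le_eqVlt => /orP[/eqP <-|t0].
      rewrite mul0r scale0r add0r.
      (* The distance hypothesis only concerns e - j; letting the multiple of
         j tend to infinity shows that N is nonnegative on J. *)
      have le2 n : r <= N e + n%:R * N j.
        rewrite -(NS.2 _ _ (ler0n _ n)); apply: le_trans (NS.1 _ _).
        by rewrite -[X in e + X]opprK; apply: rN; rewrite -scaleNr; exact: JZ.
      rewrite leNgt; apply/negP => Nj.
      have Nj' : 0 < - N j by rewrite oppr_gt0.
      have Ne : 0 <= N e.
        by have := rN 0 J0; rewrite subr0; exact: le_trans.
      have [n] : exists n, N e / - N j < n%:R.
        exists (Num.Def.archi_bound (N e / - N j)).
        by apply: archi_boundP; rewrite divr_ge0// ltW.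
      rewrite ltr_pdivrMr// => hn.
      by have := le2 n; lra.
    rewrite -(ler_pM2l (_ : 0 < t^-1)) ?invr_gt0//.
    rewrite mulrA mulVf ?gt_eqF// mul1r -(NS.2 t^-1) ?invr_ge0 ?(ltW t0)//.
    rewrite scalerDr scalerA mulVf ?gt_eqF// scale1r -[_ *: j]opprK.
    by apply: rN; rewrite -scaleNr; exact: JZ.
have [g gl gP] := minimal_sublinear_linear (sublinear_cone_inf NS PC).
have g0 : g 0 = 0 by have := gl 1 0 0; rewrite scaler0 addr0; lra.
have gN v : g (- v) = - g v.
  by have := gl (-1) v 0; rewrite addr0 scaleN1r g0 addr0 mulN1r.
have gxP x : P x -> x.2 <= g x.1.
  move=> Px; have := le_trans (gP _) (cone_infN NS PC Px).
  by rewrite gN lerN2.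
have gJ j : J j -> 0 <= g j.
  move=> Jj; apply: (gxP (j, 0)); exists 0, j.
  by rewrite scale0r add0r mul0r lexx.
exists g; split=> //.
- by move=> v; exact: le_trans (gP v) (cone_inf_le_self NS PC v).
- move=> j Jj; apply/eqP; rewrite eq_le (gJ _ Jj) andbT -oppr_ge0 -gN gJ//.
  by rewrite -scaleN1r; exact: JZ.
- by apply: (gxP (e, r)); exists 1, 0; rewrite scale1r addr0 mul1r.
Qed.

End Sublinear.

(** * Scalar fields with Hahn-Banach and suprema *)

(** A functional of norm at most 1 that vanishes on J and is at least r at a
    point whose distance to J is at least r. *)
Definition hahn_banach_separation (K : numFieldType) : Prop :=
  forall (E : normedModType K) (J : set E) (e : E) (r : K),
    J 0 -> (forall t u v, J u -> J v -> J (t *: u + v)) ->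
    0 <= r -> (forall j, J j -> r <= `|e - j|) ->
  exists f : E -> K^o, [/\ linear f, forall v, `|f v| <= `|v|,
    forall j, J j -> f j = 0 & r <= `|f e|].

(** Restricted to sets of nonnegative elements, because the order of the
    complex numbers is partial and only real elements are comparable to 0. *)
Definition sup_complete (K : numFieldType) : Prop :=
  forall S : set K, S !=set0 -> (forall x, S x -> 0 <= x) ->
  has_ubound S -> supremums S !=set0.

Section RealScalars.
Context {R : realType}.

Lemma real_hahn_banach_separation : hahn_banach_separation R.
Proof.
move=> E J e r J0 JL r0 rJ.
have NS : sublinear (fun v : E => `|v|).
  by split=> [u v|t v t0]; rewrite ?ler_normD// normrZ ger0_norm.
have [g [gl gN gJ rg]] := hahn_banach_separation_real NS J0 JL r0 rJ.
exists g; split=> // [v|]; last exact: le_trans (ler_norm _).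
have gN1 : g (- v) = - g v.
  have g0 : g 0 = 0 by have := gl 1 0 0; rewrite scaler0 addr0; lra.
  by have := gl (-1) v 0; rewrite addr0 scaleN1r g0 addr0 mulN1r.
by rewrite ler_norml gN andbT lerNl -gN1 -(normrN v) gN.
Qed.

Lemma real_sup_complete : sup_complete R.
Proof.
move=> S S0 _ Sub; exists (sup S); split=> [y Sy|]; first exact: ub_le_sup.
by move=> y; exact: ge_sup.
Qed.

End RealScalars.

Section ComplexScalars.
Context {R : realType}.
Local Open Scope complex_scope.

(** A type alias, so that restriction of scalars to the reals is a structure
    that inference does not confuse with the complex one. *)
Definition realified (V : lmodType R[i]) : Type := V.
HB.instance Definition _ (V : lmodType R[i]) := GRing.Zmodule.on (realified V).

Section Realified.
Variable V : lmodType R[i].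
Implicit Types (a b : R) (u v : realified V).

Let scale a v : realified V := a%:C *: (v : V).

Fact realified_scalerA a b v : scale a (scale b v) = scale (a * b) v.
Proof. by rewrite /scale scalerA -rmorphM. Qed.

Fact realified_scale1r : left_id 1 scale.
Proof. by move=> v; rewrite /scale rmorph1 scale1r. Qed.

Fact realified_scalerDr : right_distributive scale +%R.
Proof. by move=> a u v; rewrite /scale scalerDr. Qed.

Fact realified_scalerDl v : {morph scale^~ v : a b / a + b}.
Proof. by move=> a b; rewrite /scale rmorphD scalerDl. Qed.

HB.instance Definition _ := GRing.Zmodule_isLmodule.Build R (realified V)
  realified_scalerA realified_scale1r realified_scalerDr realified_scalerDl.

Lemma realified_scaleE a v : a *: v = a%:C *: (v : V) :> V.
Proof. by []. Qed.

End Realified.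

Lemma complexRe_le (x y : R[i]) : x <= y -> complex.Re x <= complex.Re y.
Proof. by rewrite lecE => /andP[]. Qed.

Lemma ge0_ReK (x : R[i]) : 0 <= x -> (complex.Re x)%:C = x.
Proof. by move=> x0; apply: RRe_real; rewrite ger0_real. Qed.

(** A real-linear g is the real part of the complex-linear
    v |-> g v - i g (i v). The latter vanishes on J because J is stable under
    multiplication by i, and |f v| = Re (f (c v)) for some unimodular c. *)
Lemma complex_hahn_banach_separation : hahn_banach_separation R[i].
Proof.
move=> E J e r J0 JL r0 rJ.
pose N (v : realified E) := complex.Re `|v : E|.
have NS : sublinear N.
  split=> [u v|t v t0]; rewrite /N.
    rewrite -raddfD; apply: complexRe_le; exact: ler_normD.
  rewrite realified_scaleE normrZ ger0_norm ?ler0c//.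
  by rewrite -[X in _ * X]ge0_ReK// -rmorphM.
have rJ' (j : realified E) : J j -> complex.Re r <= N ((e : realified E) - j).
  by move=> Jj; exact/complexRe_le/rJ.
have Rer0 : 0 <= complex.Re r by exact: complexRe_le r0.
have JLR t (u v : realified E) : J u -> J v -> J (t *: u + v).
  by move=> Ju Jv; exact: JL.
have [g [gl gN gJ rg]] :=
  hahn_banach_separation_real NS (J0 : (J : set (realified E)) 0) JLR Rer0 rJ'.
have gD (u v : E) : g (u + v) = g u + g v.
  by have := gl 1 u v; rewrite scale1r mul1r.
have g0 : g 0 = 0 by have := gD 0 0; rewrite addr0; lra.
have gZ t (v : E) : g (t%:C *: v) = t * g v.
  by have := gl t v 0; rewrite addr0 g0 addr0.
have gNv (v : E) : g (- v) = - g v.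
  by have := gZ (-1) v; rewrite rmorphN1 scaleN1r mulN1r.
pose f (v : E) : R[i]^o := g v -i* g ('i *: v).
have fD u v : f (u + v) = f u + f v.
  by rewrite /f scalerDr !gD opprD.
have fZ c v : f (c *: v) = c * f v.
  case: c => a b.
  have -> : (a +i* b) = a%:C + 'i * b%:C by simpc.
  have e1 (w : E) : g ((a%:C + 'i * b%:C) *: w) = a * g w + b * g ('i *: w).
    by rewrite scalerDl gD gZ (mulrC 'i) -scalerA gZ.
  rewrite /f (_ : 'i *: (_ *: v) = (a%:C + 'i * b%:C) *: ('i *: v)); last first.
    by rewrite !scalerA mulrC.
  rewrite !e1 scalerA -expr2 sqr_i scaleN1r gNv.
  simpc; apply/eqP; rewrite eq_complex /=.
  by apply/andP; split; apply/eqP; ring.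
exists f; split.
- by move=> c u v; rewrite fD fZ.
- move=> v; have [->|fv0] := eqVneq (f v) 0; first by rewrite normr0.
  pose c := `|f v| / f v.
  have c1 : `|c| = 1 by rewrite normrM normr_id normfV divff// normr_eq0.
  have fcv : f (c *: v) = `|f v| by rewrite fZ divfK.
  have := gN (c *: v); rewrite -[g _]/(complex.Re (f (c *: v))) fcv.
  rewrite /N normrZ c1 mul1r.
  move=> h; rewrite -(ge0_ReK (normr_ge0 (f v))) -(ge0_ReK (normr_ge0 v)).
  by rewrite lecR.
- move=> j Jj; rewrite /f !gJ ?oppr0//.
  by rewrite -[_ *: _]addr0; exact: JL.
- rewrite -[r]ge0_ReK//; apply: (le_trans _ (normc_ge_Re _)).
  by rewrite lecR (le_trans rg)// ler_norm.
Qed.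

Lemma complex_sup_complete : sup_complete R[i].
Proof.
move=> S [x0 Sx0] S0 [M SM].
pose T := [set complex.Re x | x in S].
have Tub : ubound T (complex.Re M) by move=> _ [x Sx <-]; exact/complexRe_le/SM.
have T0 : T !=set0 by exists (complex.Re x0), x0.
exists (sup T)%:C; split=> [x Sx|y yS].
  rewrite -(ge0_ReK (S0 _ Sx)) lecR; apply: ub_le_sup; last by exists x.
  by exists (complex.Re M).
have y0 : 0 <= y by exact: le_trans (S0 _ Sx0) (yS _ Sx0).
rewrite -(ge0_ReK y0) lecR; apply: ge_sup => // _ [x Sx <-].
exact/complexRe_le/yS.
Qed.

End ComplexScalars.

(** * Dual norms *)

Section SupComplete.
Context {K : numFieldType} (supK : sup_complete K).

Lemma supremum_lub (S : set K) : S !=set0 -> (forall x, S x -> 0 <= x) ->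
  has_ubound S ->
  ubound S (supremum 0 S) /\ forall y, ubound S y -> supremum 0 S <= y.
Proof.
move=> S0 Sge0 Sub; have [s Ss] := supK S0 Sge0 Sub.
rewrite /supremum; case: ifPn => [/eqP SE|_].
  by case: S0 => x; rewrite SE.
have : supremums S (xget 0 (supremums S)) by apply: xgetPex; exists s.
by case.
Qed.

Lemma sup_complete_archimedean (x : K) : 0 <= x -> exists n : nat, x < n%:R.
Proof.
move=> x0; apply: contrapT => /forallNP xn.
have nx n : n%:R <= x.
  by rewrite real_leNgt ?realn ?ger0_real//; apply/negP/xn.
have [s [sub lub]] : supremums [set (n%:R : K) | n in [set: nat]] !=set0.
  apply: supK; first by exists 0%:R, 0%N.
    by move=> _ [n _ <-].
  by exists x => _ [n _ <-].
have : s <= s - 1.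
  apply: lub => _ [n _ <-]; rewrite lerBrDr -[1]/(1%:R) -natrD.
  by apply: sub; exists (n + 1)%N.
by rewrite lerDl oppr_ge0 lt_geF.
Qed.

Lemma exists_small_half_pow (e : K) : 0 < e -> exists n : nat, 2^-1 ^+ n < e.
Proof.
move=> e0; have ei0 : 0 < e^-1 by rewrite invr_gt0.
have [n en] := sup_complete_archimedean (ltW ei0).
exists n; rewrite exprVn -[e]invrK ltf_pV2 ?posrE ?invr_gt0 ?exprn_gt0//.
by apply: lt_trans en _; rewrite -natrX ltr_nat ltn_expl.
Qed.

End SupComplete.

Section DualBasics.
Context {K : numFieldType} {X : normedModType K}.
Implicit Types (f g : topdual X) (x : X).

Fact dual_fun_linear f : linear (f : X -> K^o).
Proof. by case: f => f /= /asboolP[]. Qed.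

HB.instance Definition _ f :=
  GRing.isLinear.Build K X K^o _ (dual_fun f) (dual_fun_linear f).

Lemma dual_fun_continuous f : continuous (f : X -> K^o).
Proof. by case: f => f /= /asboolP[]. Qed.

Lemma dualP f g : (forall x, f x = g x) -> f = g.
Proof. by move=> fg; apply/val_inj/funext. Qed.

Lemma dual_funZ f a x : f (a *: x) = a * f x.
Proof. exact: linearZ. Qed.

Lemma dual_funD f x y : f (x + y) = f x + f y.
Proof. exact: linearD. Qed.

Lemma dual_funB f x y : f (x - y) = f x - f y.
Proof. exact: linearB. Qed.

Lemma dualD f g x : (f + g) x = f x + g x.
Proof. by []. Qed.

Lemma dualZ a f x : (a *: f) x = a * f x.
Proof. by []. Qed.

Lemma dualN f x : (- f) x = - f x.
Proof. by []. Qed.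

Lemma dual0 x : (0 : topdual X) x = 0.
Proof. by []. Qed.

Lemma dual_sum I (r : seq I) (F : I -> topdual X) x :
  (\sum_(i <- r) F i) x = \sum_(i <- r) F i x.
Proof.
by elim/big_rec2: _ => [|i y f _ <-]; rewrite ?dual0 ?dualD.
Qed.

Lemma bounded_linear_dual (g : X -> K^o) : linear g ->
  (forall x, `|g x| <= `|x|) -> exists f : topdual X, forall x, f x = g x.
Proof.
move=> gl gb; have gc : continuous g.
  pose gL := GRing.isLinear.Build K X K^o _ g gl.
  pose g' : {linear X -> K^o} := HB.pack g gL.
  apply: (@bounded_linear_continuous _ _ _ g').
  by apply/linear_boundedP; near=> r => x; rewrite (le_trans (gb x))//
    ler_peMl//; near: r; apply: nbhs_pinfty_ge.
have gd : g \in @is_dual K X by apply/asboolP.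
by exists (Dual gd).
Unshelve. all: by end_near. Qed.

Lemma dual_bounded f : exists2 M, 0 < M & forall x, `|f x| <= M * `|x|.
Proof.
have : bounded_near (f : X -> K^o) (nbhs (0 : X)).
  apply: continuous_linear_bounded; exact: dual_fun_continuous.
by move=> /linear_boundedP/pinfty_ex_gt0[M M0 Mf]; exists M.
Qed.

Hypothesis supK : sup_complete K.

Lemma dual_norm_lub f :
  ubound [set `|f x| | x in unit_ball X] (dual_norm f) /\
  forall M, (forall x, `|x| <= 1 -> `|f x| <= M) -> dual_norm f <= M.
Proof.
have [M M0 Mf] := dual_bounded f.
have [||| ub lub] := @supremum_lub _ supK [set `|f x| | x in unit_ball X].
- by exists `|f 0|, 0 => //; rewrite /unit_ball/= normr0.
- by move=> _ [x _ <-].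
- exists M => _ [x x1 <-]; rewrite (le_trans (Mf x))// ler_piMr//.
  exact: ltW.
split=> // N fN; apply: lub => _ [x x1 <-]; exact: fN.
Qed.

Lemma dual_norm_ge f x : `|x| <= 1 -> `|f x| <= dual_norm f.
Proof. by move=> x1; apply: (dual_norm_lub f).1; exists x. Qed.

Lemma dual_norm_le f M : (forall x, `|x| <= 1 -> `|f x| <= M) ->
  dual_norm f <= M.
Proof. exact: (dual_norm_lub f).2. Qed.

Lemma dual_norm_ge0 f : 0 <= dual_norm f.
Proof.
by apply: (le_trans (normr_ge0 (f 0))); apply: dual_norm_ge; rewrite normr0.
Qed.

Lemma le_dual_norm f x : `|f x| <= dual_norm f * `|x|.
Proof.
have [->|x0] := eqVneq x 0; first by rewrite linear0 !normr0 mulr0.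
have nx : 0 < `|x| by rewrite normr_gt0.
have := @dual_norm_ge f (`|x|^-1 *: x).
rewrite dual_funZ normrZ normfV normr_id mulVf ?gt_eqF// normrM normfV normr_id.
by move=> /(_ (lexx _)); rewrite mulrC ler_pdivrMr.
Qed.

Lemma dual_normZ a f : dual_norm (a *: f) = `|a| * dual_norm f.
Proof.
have le1 b g : dual_norm (b *: g) <= `|b| * dual_norm g.
  apply: dual_norm_le => x x1; rewrite dualZ normrM ler_wpM2l//.
  exact: dual_norm_ge.
have [->|a0] := eqVneq a 0.
  rewrite scale0r normr0 mul0r; apply/eqP; rewrite eq_le dual_norm_ge0 andbT.
  by apply: dual_norm_le => x _; rewrite dual0 normr0.
apply/eqP; rewrite eq_le le1 /=.
rewrite -ler_pdivlMl ?normr_gt0// -normfV; apply: le_trans (le1 _ _).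
by rewrite scalerA mulVf// scale1r.
Qed.

End DualBasics.

(** * Coordinates along L-summands *)

Section LCoordinate.
Context {K : numFieldType} {X : normedModType K}.
Hypothesis supK : sup_complete K.
Implicit Types (f g : topdual X).

(** c is the coordinate of the l1-decomposition along the line of a; its
    kernel is the complementary summand. *)
Definition L_coordinate (a : topdual X) (c : topdual X -> K^o) :=
  [/\ linear c, c a = 1 &
      forall f, dual_norm f = `|c f| + dual_norm (f - c f *: a)].

Lemma dual_norm_eq0 f : dual_norm f = 0 -> f = 0.
Proof.
move=> f0; apply: dualP => x; apply/eqP; rewrite -normr_le0.
by have := le_dual_norm supK f x; rewrite f0 mul0r.
Qed.

Lemma L_summand_coordinate (a : topdual X) :
  dual_norm a = 1 -> L_summand (scalar_line a) -> exists c, L_coordinate a c.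
Proof.
move=> a1 [Z [[Z0 Zl] YZ dec norm]].
have ZP x : (x \in mem Z) = (x \in Z) by [].
have {}Z0 : Z 0 by have := Z0; rewrite ZP inE.
have {}Zl t u v : Z u -> Z v -> Z (t *: u + v).
  move=> Zu Zv; have := Zl t u v; rewrite !ZP !inE; exact.
have a0 : a != 0.
  apply/eqP => a0; move: a1; rewrite a0 -[0](scale0r 0) dual_normZ//.
  by rewrite normr0 mul0r => /eqP; rewrite eq_sym oner_eq0.
have /choice[c cP] f : exists c : K, Z (f - c *: a).
  by have [_ [z [[c _ <-] Zz ->]]] := dec f; exists c; rewrite addrC addKr.
have uniq f t : Z (f - t *: a) -> t = c f.
  move=> Zt; have : (scalar_line a `&` Z) ((t - c f) *: a).
    split; first by exists (t - c f).
    have := Zl (-1) _ _ Zt (cP f).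
    by rewrite scaleN1r opprB addrA subrK scalerBl.
  by rewrite YZ => /eqP; rewrite scaler_eq0 (negPf a0) orbF subr_eq0 => /eqP.
exists c; split.
- move=> t f g; apply/esym/uniq.
  rewrite scalerDl -scalerA opprD addrACA -scalerBr.
  exact: Zl (cP f) (cP g).
- by apply/esym/uniq; rewrite scale1r subrr.
- move=> f; have Yc : scalar_line a (c f *: a) by exists (c f).
  rewrite -[in LHS](subrKC (c f *: a) f) (norm _ _ Yc (cP f)).
  by rewrite dual_normZ// a1 mulr1.
Qed.

Section OneCoordinate.
Variables (a : topdual X) (c : topdual X -> K^o).
Hypothesis cP : L_coordinate a c.

Lemma L_coordinate_linear t f g : c (t *: f + g) = t * c f + c g.
Proof. by case: cP => cl _ _; rewrite cl. Qed.

Lemma L_coordinateD f g : c (f + g) = c f + c g.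
Proof. by have := L_coordinate_linear 1 f g; rewrite scale1r mul1r. Qed.

Lemma L_coordinate0 : c 0 = 0.
Proof. by apply/(addIr (c 0)); rewrite -L_coordinateD !add0r. Qed.

Lemma L_coordinateZ t f : c (t *: f) = t * c f.
Proof.
by have := L_coordinate_linear t f 0; rewrite !addr0 L_coordinate0 addr0.
Qed.

Lemma L_coordinateN f : c (- f) = - c f.
Proof. by rewrite -scaleN1r L_coordinateZ mulN1r. Qed.

Lemma L_coordinate_sum I (r : seq I) (F : I -> topdual X) :
  c (\sum_(i <- r) F i) = \sum_(i <- r) c (F i).
Proof.
by elim/big_rec2: _ => [|i y f _ <-]; rewrite ?L_coordinate0 ?L_coordinateD.
Qed.

Lemma L_coordinate_self : c a = 1.
Proof. by case: cP. Qed.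

Lemma L_coordinate_norm f : dual_norm f = `|c f| + dual_norm (f - c f *: a).
Proof. by case: cP. Qed.

Lemma L_coordinate_le f : `|c f| <= dual_norm f.
Proof. by rewrite L_coordinate_norm lerDl (dual_norm_ge0 supK). Qed.

End OneCoordinate.

(** Distinct one-dimensional L-summands lie in each other's complement.
    Decompose b along a, then both parts along b: the norm of b is
    |t| + |1 - t| + 2 |u|, where u is the part of (c b) a off the line of b.
    Since b has norm 1, u = 0, that is, (c b) a is a multiple of b. *)
Lemma L_coordinate_indep (a b : topdual X) c d :
  dual_norm a = 1 -> dual_norm b = 1 ->
  L_coordinate a c -> L_coordinate b d -> ~ lin_dep a b -> c b = 0.
Proof.
move=> a1 b1 cP dP ab.
set s := c b; set t := d (s *: a); set u := s *: a - t *: b.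
have eb : 1 = `|s| + dual_norm (b - s *: a).
  by rewrite -(L_coordinate_norm cP) b1.
have es : `|s| = `|t| + dual_norm u.
  by rewrite -(L_coordinate_norm dP) dual_normZ// a1 mulr1.
have ez : dual_norm (b - s *: a) = `|1 - t| + dual_norm u.
  have dz : d (b - s *: a) = 1 - t.
    by rewrite (L_coordinateD dP) (L_coordinateN dP) (L_coordinate_self dP).
  have zu : b - s *: a - (1 - t) *: b = (-1) *: u.
    by rewrite scaleN1r /u opprB scalerBl scale1r opprB addrC subrKA.
  by rewrite (L_coordinate_norm dP) dz zu dual_normZ// normrN1 mul1r.
have : dual_norm u + dual_norm u <= 0.
  have h : `|t| + `|1 - t| + (dual_norm u + dual_norm u) = 1.
    by rewrite [RHS]eb ez es addrACA.
  rewrite -(lerD2l (`|t| + `|1 - t|)) addr0 h.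
  by rewrite -[X in X <= _]normr1 -[X in `|X| <= _](subrKC t) ler_normD.
rewrite -mulr2n pmulrn_lle0// => u0.
have {}u0 : u = 0.
  by apply: dual_norm_eq0; apply/eqP; rewrite eq_le u0 dual_norm_ge0.
apply/eqP; apply: contra_notT ab => s0; exists s, (- t); split; first by left.
by rewrite scaleNr.
Qed.

Lemma sphere_norm (a : dual_sphere X) : dual_norm (\val a : topdual X) = 1.
Proof. exact: (set_valP a). Qed.

Lemma sphere_piP (a b : dual_sphere X) :
  sphere_pi a = sphere_pi b <-> lin_dep (\val a) (\val b).
Proof.
rewrite /sphere_pi; split.
  by move/(@eqmodP _ (@sphere_equivRel K X)) => /asboolP.
by move=> ab; apply/(@eqmodP _ (@sphere_equivRel K X))/asboolP.
Qed.

(** A choice of coordinate, with a junk value when a spans no L-summand. *)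
Definition coordinate (a : topdual X) : topdual X -> K^o :=
  xget (fun=> 0) [set c | L_coordinate a c].

Lemma coordinateP (a : dual_sphere X) :
  L_summand (scalar_line (\val a)) ->
  L_coordinate (\val a) (coordinate (\val a)).
Proof.
move=> /(L_summand_coordinate (set_valP a))[c cP].
by rewrite /coordinate; apply: (xgetPex _ (ex_intro _ c cP)).
Qed.

(** Subtracting the part along the first element leaves the other coordinates
    unchanged, by [L_coordinate_indep], and lowers the norm by exactly the
    first coordinate. *)
Lemma sum_coordinate_le (s : seq (dual_sphere X)) :
  (forall a : dual_sphere X, a \in s -> L_summand (scalar_line (\val a))) ->
  uniq [seq sphere_pi a | a <- s] ->
  forall f, \sum_(a <- s) `|coordinate (\val a) f| <= dual_norm f.
Proof.
elim: s => [_ _ f|a s IH sL /= /andP[as_ us] f].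
  by rewrite big_nil dual_norm_ge0.
have aP := coordinateP (sL _ (mem_head _ _)).
rewrite big_cons (L_coordinate_norm aP) lerD2l.
apply: le_trans (IH _ us _); last first.
  by move=> b bs; apply: sL; rewrite inE bs orbT.
rewrite le_eqVlt; apply/orP; left; apply/eqP/eq_big_seq => b bs.
have bP := coordinateP (sL b (_ : b \in a :: s)); rewrite inE bs orbT in bP.
rewrite (L_coordinateD (bP isT)) (L_coordinateN (bP isT)).
rewrite (L_coordinateZ (bP isT)).
rewrite (L_coordinate_indep (sphere_norm b) (sphere_norm a) (bP isT) aP).
  by rewrite mulr0 oppr0 addr0.
move=> /sphere_piP ba; move/negP: as_; apply.
by apply/mapP; exists b.
Qed.

(** Each class counted here uses up at least e of the norm of f. *)
Lemma finite_large_coordinates (A : set (dual_sphere X)) f (e : K) : 0 < e ->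
  (forall a : dual_sphere X, A a -> L_summand (scalar_line (\val a))) ->
  finite_set (sphere_pi @`
    [set a : dual_sphere X | A a /\ e <= `|coordinate (\val a) f|]).
Proof.
move=> e0 AL; apply: contrapT => Sinf; set S := (Y in infinite_set Y) in Sinf.
have [n fn] := sup_complete_archimedean supK
  (divr_ge0 (dual_norm_ge0 supK f) (ltW e0)).
have [D DS nD] := infinite_set_fset n Sinf.
have /choice[r rP] (q : sphere_quotient X) : exists a : dual_sphere X,
    q \in D -> [/\ A a, e <= `|coordinate (\val a) f| & sphere_pi a = q].
  have [/DS[a [Aa ea] aq]|qD] := boolP (q \in D); first by exists a.
  by apply: contrapT => /forallNP /(_ (repr q)); apply.
have : \sum_(a <- [seq r q | q <- D]) `|coordinate (\val a) f| <= dual_norm f.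
  apply: sum_coordinate_le.
    by move=> _ /mapP[q /rP[Arq _ _] ->]; exact: AL.
  rewrite -map_comp map_id_in ?fset_uniq// => q /rP[_ _]//.
apply/negP; rewrite big_map big_seq.
rewrite -real_ltNge; last 2 first.
- by rewrite ger0_real// dual_norm_ge0.
- by rewrite ger0_real// sumr_ge0.
apply: (@lt_le_trans _ _ (\sum_(q <- D | q \in D) e)); last first.
  by apply: ler_sum => q /rP[].
rewrite -big_seq big_const_seq count_predT iter_addr_0 -mulr_natl.
rewrite ltr_pdivrMr// in fn; apply: (lt_le_trans fn).
by rewrite ler_pM2r// ler_nat.
Qed.

End LCoordinate.

(** * Moving a point along an L-summand *)

Section Perturbation.
Context {K : numFieldType} {X : normedModType K}.
Hypotheses (supK : sup_complete K) (hbK : hahn_banach_separation K).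
Implicit Types (f g a b : topdual X) (x : X).

Lemma prod_norm_ltP (U V : normedModType K) (u : U) (v : V) (r : K) :
  `|(u, v)| < r -> `|u| < r /\ `|v| < r.
Proof.
have cmp : (`|u| >=< `|v|)%R by apply: real_comparable; rewrite normr_real.
rewrite prod_normE /= => h; split; apply: le_lt_trans h.
  by rewrite comparable_le_max// lexx.
by rewrite comparable_le_max// lexx orbT.
Qed.

Lemma prod_norm_le (U V : normedModType K) (u : U) (v : V) (r : K) :
  `|u| <= r -> `|v| <= r -> `|(u, v)| <= r.
Proof.
have cmp : (`|u| >=< `|v|)%R by apply: real_comparable; rewrite normr_real.
by move=> ur vr; rewrite prod_normE /= comparable_ge_max// ur.
Qed.

Lemma coord_le_norm n (v : 'rV[K]_n) i : `|v 0 i| <= `|v|.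
Proof.
have -> : `|v| = mx_norm v by [].
rewrite mx_normE (_ : `|v 0 i| = `|v 0 i|%:nng%:num)// num_le.
exact: (le_bigmax _ (fun j => `|v j.1 j.2|%:nng) (0, i)).
Qed.

Lemma phase (s : K) : exists2 t : K, `|t| = 1 & t * s = `|s|.
Proof.
have [->|s0] := eqVneq s 0; first by exists 1; rewrite ?normr1 ?mulr0 ?normr0.
exists (`|s| / s); last by rewrite divfK.
by rewrite normrM normr_id normfV divff// normr_eq0.
Qed.

(** The norm dual to a maximum is a sum: the two suprema can be reached
    simultaneously after rotating each vector. *)
Lemma dual_norm_pair_le f g (r : K) :
  (forall u v, `|u| <= 1 -> `|v| <= 1 -> `|f u + g v| <= r) ->
  dual_norm f + dual_norm g <= r.
Proof.
move=> h; rewrite -lerBrDr; apply: dual_norm_le => // u u1.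
rewrite lerBrDr addrC -lerBrDr; apply: dual_norm_le => // v v1.
rewrite lerBrDr addrC.
have [s s1 su] := phase (f u); have [t t1 tv] := phase (g v).
have := h (s *: u) (t *: v); rewrite !normrZ s1 t1 !mul1r => /(_ u1 v1).
by rewrite !dual_funZ su tv ger0_norm ?addr_ge0.
Qed.

Lemma dual_value_1 a : dual_norm a = 1 -> exists e : X, a e = 1.
Proof.
move=> a1; have [x ax] : exists x, a x != 0.
  apply: contrapT => /forallNP h; move: a1.
  have -> : a = 0 by apply: dualP => x; apply/eqP/negPn/negP/h.
  rewrite -[0](scale0r 0) dual_normZ// normr0 mul0r => /eqP.
  by rewrite eq_sym oner_eq0.
by exists ((a x)^-1 *: x); rewrite dual_funZ mulVf.
Qed.

Lemma dual_ker_proportional a f (e : X) : a e = 1 ->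
  (forall x, a x = 0 -> f x = 0) -> f = f e *: a.
Proof.
move=> ae af; apply: dualP => x; rewrite dualZ.
have /af : a (x - a x *: e) = 0 by rewrite dual_funB dual_funZ ae mulr1 subrr.
by rewrite dual_funB dual_funZ => /eqP; rewrite subr_eq0 mulrC => /eqP.
Qed.

(** Finding w amounts to bounding by 1 the distance from the point v0 to the
    subspace J in the maximum norm of X * X * K^m. A functional of norm 1
    vanishing on J is a triple (f, g, t) with |f| + |g| <= 1 and such that
    f + g / eta + h is a multiple of a, where h is a combination of the z i
    and so has no coordinate along a. Splitting f along a bounds the value at v0
    of the triple by |c f| + |f - c f a| + |c g| <= |f| + |g| <= 1. *)
Lemma L_coordinate_perturbation a c (x : X) (mu eta eps : K) m
    (z : 'I_m -> topdual X) :
  dual_norm a = 1 -> L_coordinate a c -> `|x| <= 1 -> `|a x + mu| <= 1 ->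
  0 < eta -> `|mu| <= eta -> 0 < eps -> (forall i, c (z i) = 0) ->
  exists w : X, [/\ `|x + w| < 1 + eps, `|w| < eta * (1 + eps), a w = mu &
    forall i, `|z i w| < eps].
Proof.
move=> a1 cP x1 axmu eta0 mueta eps0 cz.
have [e ae] := dual_value_1 a1.
pose E : normedModType K := (X * X * 'rV[K]_m)%type.
pose d := eps / (1 + eps).
have e1 : 0 < 1 + eps by rewrite addr_gt0.
have d0 : 0 < d by rewrite divr_gt0.
(* With this weight the bound d^-1 |z i w| < 1 + eps reads |z i w| < eps. *)
pose T (w : X) : E := (w, eta^-1 *: w, \row_i (d^-1 * z i w)).
have TL : linear T.
  move=> t u v; rewrite /T; congr (_, _, _).
    by rewrite /= scalerDr !scalerA (mulrC t).
  rewrite /=; apply/rowP => i.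
  by rewrite !mxE dual_funD dual_funZ mulrDr mulrCA.
pose J : set E := T @` [set w | a w = 0].
pose v0 : E := (x, 0, 0) + T (mu *: e).
suff [w aw Tw] : exists2 w, a w = 0 & `|v0 - T w| < 1 + eps.
  have TB u v : T (u - v) = T u - T v.
    by rewrite addrC -scaleN1r TL scaleN1r addrC.
  move: Tw; rewrite /v0 -addrA -TB; set y := mu *: e - w.
  have ay : a y = mu by rewrite dual_funB dual_funZ ae aw subr0 mulr1.
  move=> /prod_norm_ltP[/prod_norm_ltP[xy]]; rewrite /= add0r => ny nz.
  exists y; split=> //.
    move: ny; rewrite normrZ normfV gtr0_norm// => ny.
    by rewrite mulrC -ltr_pdivrMr// mulrC.
  move=> i; have := le_lt_trans (coord_le_norm _ i) nz.
  rewrite !mxE add0r normrM normfV (gtr0_norm d0) mulrC ltr_pdivrMr//.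
  by rewrite mulrC divfK// gt_eqF.
apply: contrapT => no.
have far j : J j -> 1 + eps <= `|v0 - j|.
  move=> [w aw <-]; rewrite real_leNgt ?normr_real ?gtr0_real//.
  by apply/negP => h; apply: no; exists w.
have J0 : J 0.
  exists 0; first by rewrite /= linear0.
  by have := TL (-1) 0 0; rewrite scaler0 addr0 scaleN1r addNr.
have JL t u v : J u -> J v -> J (t *: u + v).
  move=> [u' au <-] [v' av <-]; exists (t *: u' + v'); last by rewrite TL.
  by rewrite /= dual_funD dual_funZ au av mulr0 addr0.
have [F [Fl Fn FJ Fv]] := hbK J0 JL (ltW e1) far.
have FD u v : F (u + v) = F u + F v.
  by have := Fl 1 u v; rewrite !scale1r.
have F0 : F 0 = 0 by apply/(addIr (F 0)); rewrite -FD !add0r.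
have FZ t u : F (t *: u) = t * F u.
  by have := Fl t u 0; rewrite F0 !addr0.
have [f fE] : exists f : topdual X, forall u, f u = F (u, 0, 0).
  apply: bounded_linear_dual.
    move=> t u v; rewrite -Fl; congr F; congr (_, _, _).
      by rewrite /= scaler0 addr0.
    by rewrite /= scaler0 addr0.
  move=> u; apply: le_trans (Fn _) _.
  by do 2 ?apply: prod_norm_le; rewrite ?normr0.
have [g gE] : exists g : topdual X, forall u, g u = F (0, u, 0).
  apply: bounded_linear_dual.
    move=> t u v; rewrite -Fl; congr F; congr (_, _, _).
      by rewrite /= scaler0 addr0.
    by rewrite /= scaler0 addr0.
  move=> u; apply: le_trans (Fn _) _.
  by do 2 ?apply: prod_norm_le; rewrite ?normr0.
have fg1 : dual_norm f + dual_norm g <= 1.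
  apply: dual_norm_pair_le => u v u1 v1; rewrite fE gE -FD.
  apply: le_trans (Fn _) _.
  rewrite (_ : (_ + _) = (u, v, 0)); last first.
    by congr (_, _, _); rewrite /= ?addr0 ?add0r.
  by do 2 ?apply: prod_norm_le; rewrite ?normr0.
pose h : topdual X := \sum_i (F (0, 0, delta_mx 0 i) * d^-1) *: z i.
have hE w : h w = F (0, 0, \row_i (d^-1 * z i w)).
  rewrite dual_sum; pose G (v : 'rV[K]_m) := F (0, 0, v).
  have GD u v : G (u + v) = G u + G v.
    by rewrite /G -FD; congr F; congr (_, _, _); rewrite /= addr0.
  have G0 : G 0 = 0 by exact: F0.
  have GZ t v : G (t *: v) = t * G v.
    by rewrite /G -FZ; congr F; congr (_, _, _); rewrite /= scaler0.
  rewrite -/(G _) [X in G X]row_sum_delta.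
  rewrite (big_morph G GD G0); apply: eq_bigr => i _.
  by rewrite GZ mxE dualZ -mulrA [LHS]mulrC.
(* f, g and h are the three components of F pulled back along T. *)
have FT w : F (T w) = f w + eta^-1 * g w + h w.
  rewrite fE gE hE -FZ -!FD; congr F; congr (_, _, _) => /=.
  - by rewrite scaler0 !addr0.
  - by rewrite add0r addr0.
  - by rewrite scaler0 !add0r.
pose l := f + eta^-1 *: g + h.
have lE w : l w = F (T w) by rewrite FT.
have lker w : a w = 0 -> l w = 0.
  by move=> aw; rewrite lE; apply: FJ; exists w.
have la := dual_ker_proportional ae lker.
set k := l e in la.
have ch : c h = 0.
  rewrite (L_coordinate_sum cP) big1// => i _.
  by rewrite (L_coordinateZ cP) cz mulr0.
have ck : c f + eta^-1 * c g = k.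
  have := congr1 c la; rewrite !(L_coordinateD cP) !(L_coordinateZ cP) ch.
  by rewrite (L_coordinate_self cP) addr0 mulr1.
have Fv0 : F v0 = c f * (a x + mu) + (f - c f *: a) x + eta^-1 * c g * mu.
  rewrite FD -fE -lE [in l _]la dualZ dual_funZ ae mulr1 -ck dualD dualN dualZ.
  ring.
have : `|F v0| <= 1.
  apply: le_trans fg1; rewrite Fv0 (L_coordinate_norm cP f).
  apply: le_trans (ler_normD _ _) _; apply: lerD.
    apply: le_trans (ler_normD _ _) _; apply: lerD.
      by rewrite normrM ler_piMr.
    exact: dual_norm_ge.
  rewrite normrM normrM normfV (gtr0_norm eta0) mulrAC mulrC.
  apply: le_trans (L_coordinate_le supK cP g).
  by rewrite ler_piMr// mulrC ler_pdivrMr// mul1r.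
by move=> /(le_trans Fv); rewrite gerDl => /le_gtF; rewrite eps0.
Qed.

End Perturbation.

(** * Weak and weak-star neighbourhoods *)

Section WeakTopologies.
Context {K : numFieldType} {X : normedModType K}.
Hypothesis supK : sup_complete K.

(** Radius 1 is enough, because the functionals can be rescaled; neighbourhoods
    then intersect by concatenation of lists. *)
Definition weak_basic (x : X) (s : seq (topdual X)) : set X :=
  [set y | forall f, f \in s -> `|f y - f x| < 1].

Lemma weak_basic_filter (x : X) :
  Filter [set S : set X | exists s, weak_basic x s `<=` S].
Proof.
split.
- by exists [::].
- move=> S T [s sS] [t tT]; exists (s ++ t) => y yst; split.
    by apply: sS => f fs; apply: yst; rewrite mem_cat fs.
  by apply: tT => f ft; apply: yst; rewrite mem_cat ft orbT.
- by move=> S T ST [s sS]; exists s; exact: subset_trans sS ST.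
Qed.

(** The filter generated by the basic sets at x converges to x, since it does
    so along every functional. *)
Lemma weak_open_basic (U : set (weak_space X)) (x : X) :
  open U -> U x -> exists s, weak_basic x s `<=` U.
Proof.
move=> [V Vo <-] Ux.
pose ev (x : X) : {ptws topdual X -> K^o} := fun f : topdual X => f x.
have GF := weak_basic_filter x; set G := (X in Filter X) in GF.
suff : cvg_to (fmap ev G) (nbhs (ev x)).
  by move=> /(_ V); apply; exact: open_nbhs_nbhs.
have evF : Filter (fmap ev G) by exact: fmap_filter.
apply/cvg_sup => f B; rewrite nbhsE => - [_ [[C Co <-] Cx] CB].
have /nbhs_ballP[e /= e0 eC] : nbhs (f x : K^o) C by exact: open_nbhs_nbhs.
exists [:: e^-1 *: f] => y ys; apply: CB; apply: eC.
have := ys (e^-1 *: f) (mem_head _ _); rewrite !dualZ -mulrBr normrM.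
by rewrite gtr0_norm ?invr_gt0// mulrC ltr_pdivrMr// mul1r distrC.
Qed.

Lemma sphere_eval_continuous (x : X) :
  continuous (fun a : dual_sphere X => (\val a : topdual X) x : K^o).
Proof.
have c1 : continuous (fun a : dual_sphere X => \val a : weak_star_dual X).
  exact: initial_continuous.
have c2 : continuous (fun a : weak_star_dual X =>
    ((a : topdual X) : X -> K^o) : {ptws X -> K^o}).
  exact: initial_continuous.
have c3 : continuous (fun g : {ptws X -> K^o} => g x) by exact: proj_continuous.
apply/continuousP => B Bo.
have B3 := (continuousP _).1 c3 B Bo.
have B2 := (continuousP _).1 c2 _ B3.
exact: ((continuousP _).1 c1 _ B2).
Qed.

Lemma open_norm_gt (r : K) : 0 <= r -> open [set z : K^o | r < `|z|].
Proof.
move=> r0; rewrite openE => z /= rz; apply/nbhs_ballP.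
exists (`|z| - r); first by rewrite /= subr_gt0.
move=> y /=; rewrite /ball /= => zy.
rewrite real_ltNge ?normr_real ?ger0_real//; apply/negP => yr.
have := le_lt_trans (lerB_dist z y) zy; rewrite ltrD2l ltrN2.
by move=> /lt_le_trans /(_ yr); rewrite ltxx.
Qed.

Lemma lin_dep_unit (a b : dual_sphere X) : lin_dep (\val a) (\val b) ->
  exists2 t : K, `|t| = 1 & (\val a : topdual X) = t *: (\val b : topdual X).
Proof.
move=> [s [t [st /eqP e]]].
have s0 : s != 0.
  apply/eqP => s0; case: st => [|t0]; first by rewrite s0 eqxx.
  move: e; rewrite s0 scale0r add0r scaler_eq0 (negPf t0) /=.
  by rewrite (negPf (dual_sphere_neq0 b)).
have ab : (\val a : topdual X) = (- (s^-1 * t)) *: (\val b : topdual X).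
  move: e; rewrite addr_eq0 => /eqP/(congr1 ( *:%R s^-1)).
  by rewrite scalerA mulVf// scale1r scalerN scalerA scaleNr.
exists (- (s^-1 * t)) => //.
have := congr1 (@dual_norm K X) ab.
by rewrite (dual_normZ supK) !sphere_norm mulr1 => <-.
Qed.

Lemma lin_dep_cross (a b : dual_sphere X) :
  (forall x y, (\val b : topdual X) y * (\val a : topdual X) x =
               (\val b : topdual X) x * (\val a : topdual X) y) ->
  lin_dep (\val a) (\val b).
Proof.
move=> ab; have [y by0] : exists y, (\val b : topdual X) y != 0.
  apply: contrapT => /forallNP h; have /eqP := dual_sphere_neq0 b; apply.
  by apply: dualP => x; apply/eqP/negPn/negP/h.
exists ((\val b : topdual X) y), (- (\val a : topdual X) y).
split; first by left.
apply: dualP => x; rewrite dualD !dualZ dual0 mulNr ab.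
by rewrite mulrC subrr.
Qed.

(** The class of b is cut out by the equations b y * a x = b x * a y, each of
    which is closed in the weak-star topology. *)
Lemma sphere_quotient_accessible : accessible_space (sphere_quotient X).
Proof.
apply/accessible_finite_set_closed => F Ffin.
rewrite -(fsbig_setU_set1 Ffin) fsbig_finite//=.
apply: closed_bigsetU => q _.
suff oq : open (~` [set q]).
  by rewrite -[X in closed X]setCK; exact: open_closedC.
have [b <-] : exists b, sphere_pi b = q by exists (repr q); exact: reprK.
rewrite /open /= /quotient_open.
rewrite (_ : _ @^-1` _ = \bigcup_(p in [set: X * X])
  [set a : dual_sphere X |
     0 < `|(\val b : topdual X) p.2 * (\val a : topdual X) p.1
           - (\val b : topdual X) p.1 * (\val a : topdual X) p.2|]).
  apply: bigcup_open => -[x y] _.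
  pose G (a : dual_sphere X) : K^o :=
    (\val b : topdual X) y *: ((\val a : topdual X) x : K^o)
     - (\val b : topdual X) x *: ((\val a : topdual X) y : K^o).
  have Gc : continuous G.
    move=> a; have cx := @sphere_eval_continuous x a.
    have cy := @sphere_eval_continuous y a.
    exact: (cvgB (cvgZl_tmp (k := _ y) cx) (cvgZl_tmp (k := _ x) cy)).
  by move/continuousP: Gc => /(_ _ (open_norm_gt (lexx 0))).
apply/seteqP; split=> a /=.
  move=> ab; apply: contrapT => h; apply: ab; apply/sphere_piP/lin_dep_cross.
  move=> x y; apply/eqP; rewrite -subr_eq0 -normr_le0.
  rewrite real_leNgt ?normr_real//; apply/negP => xy; apply: h.
  by exists (x, y).
move=> [[x y] _ /=] h /sphere_piP/lin_dep_unit[t _ ab].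
have comm (u v w : K) : u * (w * v) - v * (w * u) = 0 by ring.
move: h; rewrite ab !dualZ comm.
by rewrite normr0 ltxx.
Qed.

(** |a x| depends only on the class of a, and points are closed, so the classes
    with large value at x and outside F, except possibly that of a, form a
    neighbourhood of the class of a. *)
Lemma limit_class_near (A : set (dual_sphere X)) (F : set (sphere_quotient X))
    (a : dual_sphere X) (x : X) (r : K) :
  0 <= r -> r < `|(\val a : topdual X) x| -> finite_set F ->
  limit_point (sphere_pi @` A) (sphere_pi a) ->
  exists b, [/\ A b, ~ F (sphere_pi b) & r < `|(\val b : topdual X) x|].
Proof.
move=> r0 rax Ffin lim.
pose U : set (sphere_quotient X) :=
  [set q | exists2 b, sphere_pi b = q & r < `|(\val b : topdual X) x|].
have Uo : open U.
  rewrite /open /= /quotient_open.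
  rewrite (_ : _ @^-1` _ =
      [set b : dual_sphere X | r < `|(\val b : topdual X) x|]).
    have /continuousP := @sphere_eval_continuous x.
    by move=> /(_ _ (open_norm_gt r0)).
  apply/seteqP; split=> b /=; last by exists b.
  move=> [d /sphere_piP/lin_dep_unit[t t1 ->]].
  by rewrite dualZ normrM t1 mul1r.
have Fo : open (~` (F `\ sphere_pi a)).
  apply: closed_openC.
  have cl := (@accessible_finite_set_closed _).1 sphere_quotient_accessible.
  apply: cl.
  by apply: sub_finite_set Ffin => q [].
have UFa : nbhs (sphere_pi a) (U `&` ~` (F `\ sphere_pi a)).
  apply: open_nbhs_nbhs; split; first exact: openI.
  by split; [exists a|case=> _ /(_ erefl)].
have [q [/eqP qa [b Ab bq] [[d dq rd] Fb]]] := lim _ UFa; exists b; split=> //.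
  by rewrite bq => Fq; exact: Fb.
have /sphere_piP/lin_dep_unit[t t1 ->] : sphere_pi b = sphere_pi d.
  by rewrite bq.
by rewrite dualZ normrM t1 mul1r.
Qed.

End WeakTopologies.

(** * Large weak moves and small norm moves in the unit ball *)

Section MovingPoints.
Context {K : numFieldType} {X : normedModType K}.
Hypotheses (supK : sup_complete K) (hbK : hahn_banach_separation K).
Implicit Types (f g a b : topdual X) (x : X).

Lemma dual_norm_seq_bound (s : seq (topdual X)) :
  exists2 M : K, 1 <= M & forall f, f \in s -> 1 + dual_norm f <= M.
Proof.
elim: s => [|f s [M M1 sM]]; first by exists 1.
have f0 := dual_norm_ge0 supK f.
exists (M + dual_norm f) => [|g]; first by rewrite ler_wpDr.
rewrite inE => /orP[/eqP ->|/sM gM]; first by rewrite lerD2r.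
by rewrite ler_wpDr.
Qed.

Lemma shrink_dist (x : X) (eps : K) : 0 < eps -> `|x| <= 1 + eps ->
  `|(1 + eps)^-1 *: x| <= 1 /\ `|x - (1 + eps)^-1 *: x| <= eps.
Proof.
move=> e0 xe; have e1 : 0 < 1 + eps by rewrite addr_gt0.
have y1 : `|(1 + eps)^-1 *: x| <= 1.
  by rewrite normrZ normfV gtr0_norm// ler_pdivrMl// mulr1.
split=> //; set y := _ *: x.
have -> : x = (1 + eps) *: y by rewrite scalerA divff ?scale1r ?gt_eqF.
rewrite scalerDl scale1r addrAC subrr add0r normrZ gtr0_norm//.
by rewrite ler_piMr// ltW.
Qed.

(** Apply the perturbation with no constraint on the size of w (eta = 2) to the
    components f - c f a, then shrink x + w into the ball. The value of f moves
    by at most |c f| |mu|, where |mu| <= 2, up to errors. *)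
Lemma L_coordinate_prescribe a c (x : X) (lam d e : K) (s : seq (topdual X)) :
  dual_norm a = 1 -> L_coordinate a c -> `|x| <= 1 -> `|lam| <= 1 ->
  0 < e -> (forall f, f \in s -> `|c f| <= d) ->
  exists y : X, [/\ `|y| <= 1, `|a y - lam| <= e &
    forall f, f \in s -> `|f y - f x| <= d * 2 + e].
Proof.
move=> a1 cP x1 lam1 e0 sd; have [M M1 sM] := dual_norm_seq_bound s.
have M0 : 0 < M by exact: lt_le_trans M1.
pose eps := e / M; have eps0 : 0 < eps by rewrite divr_gt0.
have epse : eps <= e by rewrite ler_pdivrMr// ler_peMr// ltW.
pose z (i : 'I_(size s)) := nth 0 s i - c (nth 0 s i) *: a.
pose mu := lam - a x.
have mu2 : `|mu| <= 2.
  apply: le_trans (ler_normB _ _) _.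
  by rewrite -[2]/(1 + 1) lerD// (le_trans (dual_norm_ge supK a x1))// a1.
have [|i|w [xw _ aw zw]] := L_coordinate_perturbation supK hbK (m := size s)
    (z := z) a1 cP x1 _ (ltr0n _ 2) mu2 eps0.
- by rewrite /mu addrC subrK.
- rewrite /z (L_coordinateD cP) (L_coordinateN cP) (L_coordinateZ cP).
  by rewrite (L_coordinate_self cP) mulr1 subrr.
have [] := shrink_dist eps0 (ltW xw); set y := _ *: _ => y1 xwy.
exists y; split=> //.
  have -> : lam = a (x + w) by rewrite dual_funD aw /mu addrC subrK.
  rewrite distrC -dual_funB; apply: le_trans (le_dual_norm supK _ _) _.
  by rewrite a1 mul1r (le_trans xwy).
move=> f fs; have fi : (index f s < size s)%N by rewrite index_mem.
have fw : `|f w| <= d * 2 + eps.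
  have := zw (Ordinal fi); rewrite /z.
  have -> : nth 0 s (Ordinal fi) = f by exact: nth_index.
  rewrite dualD dualN dualZ aw => /ltW zf.
  rewrite -[f w](subrK (c f * mu)); apply: le_trans (ler_normD _ _) _.
  by rewrite addrC lerD// normrM ler_pM// sd.
have fxwy : `|f (x + w) - f y| <= dual_norm f * eps.
  rewrite -dual_funB; apply: le_trans (le_dual_norm supK _ _) _.
  by rewrite ler_wpM2l// dual_norm_ge0.
have -> : f y - f x = f w - (f (x + w) - f y).
  by rewrite dual_funD; ring.
apply: le_trans (ler_normB _ _) _; apply: le_trans (lerD fw fxwy) _.
rewrite -addrA lerD2l -[X in X + _]mul1r -mulrDl.
by rewrite /eps mulrA ler_pdivrMr// mulrC ler_wpM2l ?sM// ltW.
Qed.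

(** The perturbation that brings a(x) to the unit circle has size about eta;
    shrinking back into the ball with eps = eta / 2 costs half of the gain. *)
Lemma norm_attaining_step a c (x : X) (eta : K) :
  dual_norm a = 1 -> L_coordinate a c -> `|x| <= 1 -> 0 < eta -> eta <= 1 ->
  1 - eta <= `|a x| -> exists u : X,
  [/\ `|u| <= 1, 1 - eta / 2 <= `|a u| & `|u - x| <= eta * 2].
Proof.
move=> a1 cP x1 eta0 eta1 ax; have [t t1 tax] := phase (a x).
have t0 : t != 0 by rewrite -normr_eq0 t1 oner_eq0.
have ax1 : `|a x| <= 1 by rewrite (le_trans (dual_norm_ge supK a x1))// a1.
pose mu := t^-1 - a x.
have mueta : `|mu| <= eta.
  have -> : mu = t^-1 * (1 - `|a x|) by rewrite /mu -tax; field.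
  rewrite normrM normfV t1 invr1 mul1r ger0_norm ?subr_ge0//.
  by rewrite lerBlDl -lerBlDr.
pose eps := eta / 2; have eps0 : 0 < eps by rewrite divr_gt0.
have [|w [xw we aw _]] := L_coordinate_perturbation supK hbK (m := 0)
    (z := fun=> 0) a1 cP x1 _ eta0 mueta eps0 (fun=> L_coordinate0 cP).
  by rewrite /mu addrC subrK normfV t1 invr1.
have axw : a (x + w) = t^-1 by rewrite dual_funD aw /mu addrC subrK.
have [] := shrink_dist eps0 (ltW xw); set u := _ *: _ => u1 xwu.
exists u; split=> //.
  have : `|a (x + w)| <= `|a u| + eps.
    rewrite -[x + w](subrK u) dual_funD addrC.
    apply: le_trans (ler_normD _ _) _.
    rewrite lerD2l (le_trans (le_dual_norm supK _ _))// a1 mul1r//.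
  by rewrite axw normfV t1 invr1 lerBlDr.
have -> : u - x = w - (x + w - u) by rewrite opprB [RHS]addrC opprD addrA subrK.
apply: le_trans (ler_normB _ _) _; apply: le_trans (lerD (ltW we) xwu) _.
rewrite -subr_ge0 /eps (_ : _ - _ = eta / 2 * (1 - eta)); last by field.
by rewrite mulr_ge0 ?subr_ge0// ltW// divr_gt0.
Qed.

End MovingPoints.

Section Attaining.
Context {K : numFieldType} {X : completeNormedModType K}.
Hypotheses (supK : sup_complete K) (hbK : hahn_banach_separation K).

Lemma geometric_cauchy_limit (u : nat -> X) (b : K) : 0 <= b ->
  (forall n k, `|u n - u (n + k)%N| <= b * 2^-1 ^+ n) ->
  exists l : X, forall e : K, 0 < e ->
  exists2 n, `|l - u n| <= e & 2^-1 ^+ n <= e.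
Proof.
move=> b0 ub.
have : cauchy (fmap u eventually).
  apply: cauchy_exP => e e0; have b1 : 0 < b + 1 by rewrite ltr_wpDl.
  have [n ne] := exists_small_half_pow supK (divr_gt0 e0 b1).
  exists (u n); exists n => // m /= nm; rewrite -ball_normE /=.
  rewrite -(subnKC nm); apply: le_lt_trans (ub _ _) _.
  apply: (@le_lt_trans _ _ ((b + 1) * 2^-1 ^+ n)).
    by rewrite ler_wpM2r ?exprn_ge0// lerDl.
  by rewrite mulrC -ltr_pdivlMr.
move=> /cauchy_cvgP/cvg_ex[l /cvgrPdist_lt ul]; exists l => e e0.
have [N _ Nl] := ul e e0; have [m me] := exists_small_half_pow supK e0.
exists (N + m)%N; first by apply/ltW/Nl; rewrite /= leq_addr.
apply: le_trans (ltW me); rewrite exprD ler_piMl ?exprn_ge0//.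
by rewrite exprn_ile1// invf_le1// ler1n.
Qed.

(** Iterating the previous step with defects eta / 2^n: the total displacement
    is at most the sum of the 2 eta / 2^n. *)
Lemma norm_attaining_near (a : topdual X) c (x : X) (eta : K) :
  dual_norm a = 1 -> L_coordinate a c -> `|x| <= 1 -> 0 < eta -> eta <= 1 ->
  1 - eta <= `|a x| ->
  exists y : X, [/\ `|y| <= 1, `|a y| = 1 & `|y - x| <= eta * 4].
Proof.
move=> a1 cP x1 eta0 eta1 ax.
pose h n : K := 2^-1 ^+ n.
have h0 n : 0 < h n by rewrite exprn_gt0.
have h1 n : h n <= 1 by rewrite exprn_ile1// invf_le1// ler1n.
have hS n : h n.+1 = h n / 2 by rewrite /h exprSr.
have step (nx : nat * X) : exists u : X,
    `|nx.2| <= 1 -> 1 - eta * h nx.1 <= `|a nx.2| ->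
    [/\ `|u| <= 1, 1 - eta * h nx.1.+1 <= `|a u| &
        `|u - nx.2| <= eta * h nx.1 * 2].
  have [[n1 an]|no] := pselect (`|nx.2| <= 1 /\ 1 - eta * h nx.1 <= `|a nx.2|).
    have [||u [u1 au ux]] := norm_attaining_step supK hbK a1 cP n1 _ _ an.
    - by rewrite mulr_gt0.
    - by rewrite mulr_ile1// ltW.
    by exists u => _ _; split=> //; rewrite hS mulrA.
  by exists 0 => n1 an; case: no.
have [g gP] := choice step.
pose u := fix u n := if n is n'.+1 then g (n', u n') else x.
have uP n : `|u n| <= 1 /\ 1 - eta * h n <= `|a (u n)|.
  elim: n => [|n [un aun]]; first by rewrite /h expr0 mulr1.
  by have [? ? _] := gP (n, u n) un aun.
have uS n : `|u n.+1 - u n| <= eta * h n * 2.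
  by have [un aun] := uP n; have [_ _] := gP (n, u n) un aun.
have ub n k : `|u n - u (n + k)%N| <= eta * 4 * h n - eta * 4 * h (n + k)%N.
  elim: k => [|k IH]; first by rewrite addn0 !subrr normr0.
  rewrite -[u n](subrK (u (n + k)%N)) -addrA addnS.
  apply: le_trans (ler_normD _ _) _.
  have := uS (n + k)%N; rewrite distrC => /(lerD IH)/le_trans; apply.
  by rewrite hS le_eqVlt; apply/orP; left; apply/eqP; field.
have ub' n k : `|u n - u (n + k)%N| <= eta * 4 * h n.
  by apply: le_trans (ub n k) _; rewrite gerBl !mulr_ge0// ltW.
have eta4 : 0 <= eta * 4 by rewrite mulr_ge0// ltW.
have [l lP] := geometric_cauchy_limit eta4 ub'.
have l1 : `|l| <= 1.
  apply/ler_addgt0Pr => e /lP[n ln _]; rewrite -[l](subrK (u n)) addrC.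
  apply: le_trans (ler_normD _ _) _.
  by rewrite addrC [leRHS]addrC lerD// (uP n).1.
exists l; split=> //.
- apply/eqP; rewrite eq_le; apply/andP; split.
    by rewrite (le_trans (dual_norm_ge supK a l1))// a1.
  apply/ler_addgt0Pr => e e0; have e2 : 0 < e / 2 by rewrite divr_gt0.
  have [n ln hn] := lP _ e2; have [_] := uP n.
  rewrite lerBlDr => /le_trans; apply.
  have -> : e = e / 2 + e / 2 by field.
  rewrite addrA lerD//; last first.
    by apply: le_trans hn; rewrite ler_piMl// ltW.
  rewrite -lerBlDl (le_trans (lerB_dist _ _))// -dual_funB.
  rewrite (le_trans (le_dual_norm supK _ _))// a1 mul1r distrC//.
- apply/ler_addgt0Pr => e /lP[n ln _].
  rewrite -[l](subrK (u n)) -addrA addrC; apply: le_trans (ler_normD _ _) _.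
  rewrite lerD// distrC; have := ub' 0%N n.
  by rewrite add0n /h expr0 mulr1.
Qed.

End Attaining.

(** * The weak diametral diameter two property *)

Section WeakDD2P.
Context {K : numFieldType} {X : completeNormedModType K}.
Hypotheses (supK : sup_complete K) (hbK : hahn_banach_separation K).

Definition large_classes (A : set (dual_sphere X)) (s : seq (topdual X))
    (d : K) : set (sphere_quotient X) :=
  \bigcup_(f in [set` s])
    (sphere_pi @` [set a | A a /\ d <= `|coordinate (\val a : topdual X) f|]).

Lemma finite_large_classes A s d : 0 < d ->
  (forall a, A a -> L_summand (scalar_line (\val a : topdual X))) ->
  finite_set (large_classes A s d).
Proof.
move=> d0 AL; apply: bigcup_finite; first exact: finite_seq.
by move=> f _; exact: finite_large_coordinates.
Qed.

Lemma notin_large_classes A s d a : 0 < d -> A a ->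
  ~ large_classes A s d (sphere_pi a) ->
  forall f, f \in s -> `|coordinate (\val a : topdual X) f| <= d.
Proof.
move=> d0 Aa nl f fs; rewrite real_leNgt ?normr_real ?gtr0_real//.
apply/negP => /ltW dl; apply: nl; exists f => //.
by exists a.
Qed.

(** Removing the finitely many classes with large coordinates leaves a cluster
    class a. A large move brings a(x0) close to 1 and a small move makes the
    modulus exactly 1. *)
Lemma attaining_point_in_weak_open (A : set (dual_sphere X))
    (U : set (weak_space X)) (x0 : X) :
  (forall a, A a -> L_summand (scalar_line (\val a : topdual X))) ->
  infinite_set (limit_point (sphere_pi @` A) `&` (sphere_pi @` A)) ->
  open U -> `|x0| <= 1 -> U x0 ->
  exists a x, [/\ limit_point (sphere_pi @` A) (sphere_pi a), `|x| <= 1, U x &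
    `|(\val a : topdual X) x| = 1].
Proof.
move=> AL inf Uo x01 Ux0; have [s sU] := weak_open_basic Uo Ux0.
have q0 : 0 < 4^-1 :> K by rewrite invr_gt0.
have [q [[ql [a Aa aq]] qs]] : exists q,
    (limit_point (sphere_pi @` A) `&` (sphere_pi @` A)) q /\
    ~ large_classes A s 4^-1 q.
  apply: contrapT => h; apply: inf.
  apply: sub_finite_set (finite_large_classes s q0 AL) => q Sq.
  by apply: contrapT => nq; apply: h; exists q.
rewrite -aq in ql qs.
have small := notin_large_classes q0 Aa qs.
have aP := coordinateP supK (AL a Aa).
have a1 := sphere_norm a.
have [M M1 sM] := dual_norm_seq_bound supK s.
have M0 : 0 < M by exact: lt_le_trans M1.
(* The three displacements of f add up to at most
   1/4 + (2/4 + 1/16) < 1, for the small move and the large one. *)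
pose eta := (16 * M)^-1.
have eta0 : 0 < eta by rewrite invr_gt0 mulr_gt0.
have eta16 : eta <= 16^-1.
  by rewrite lef_pV2 ?posrE ?mulr_gt0// ler_peMr.
have n1 : `|1 : K| <= 1 by rewrite normr1.
have [y [y1 ay ys]] := L_coordinate_prescribe supK hbK a1 aP x01 n1 eta0 small.
have eta1 : eta <= 1 by rewrite (le_trans eta16)// invf_le1// ler1n.
have ay1 : 1 - eta <= `|(\val a : topdual X) y|.
  rewrite lerBlDl -lerBlDr -[X in X - _]normr1.
  by rewrite (le_trans (lerB_dist _ _))// distrC.
have [x [x1 ax xy]] := norm_attaining_near supK hbK a1 aP y1 eta0 eta1 ay1.
exists a, x; split=> //; apply: sU => f fs.
have -> : f x - f x0 = f (x - y) + (f y - f x0) by rewrite dual_funB; ring.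
apply: le_lt_trans (ler_normD _ _) _.
have fxy : `|f (x - y)| <= 4^-1.
  apply: le_trans (le_dual_norm supK _ _) _.
  apply: (@le_trans _ _ (M * (eta * 4))).
    rewrite ler_pM// ?dual_norm_ge0//.
    by apply: le_trans (sM f fs); rewrite lerDr.
  rewrite /eta le_eqVlt; apply/orP; left; apply/eqP; field.
  by rewrite gt_eqF.
apply: le_lt_trans (lerD fxy (ys f fs)) _.
apply: (@le_lt_trans _ _ (4^-1 + (4^-1 * 2 + 16^-1))); first by rewrite !lerD2l.
rewrite -subr_gt0 (_ : _ - _ = 3 / 16); last by field.
by rewrite divr_gt0.
Qed.

(** Functionals b of A near the class of a almost attain their norm at x, and
    avoiding finitely many classes leaves b with small coordinates on the
    functionals that define V; so b can be flipped inside V. *)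
Lemma supremum_dist_attaining (A : set (dual_sphere X)) (V : set X)
    (a : dual_sphere X) (x : X) :
  (forall a, A a -> L_summand (scalar_line (\val a : topdual X))) ->
  limit_point (sphere_pi @` A) (sphere_pi a) ->
  `|x| <= 1 -> `|(\val a : topdual X) x| = 1 ->
  rel_weakly_open V -> V x -> supremum 0 [set `|x - y| | y in V] = 2.
Proof.
move=> AL al x1 ax [U Uo VU] Vx.
have [_ Ux] : (unit_ball X `&` U) x by rewrite -VU.
have [s sU] := weak_open_basic Uo Ux.
have ub2 : ubound [set `|x - y| | y in V] 2.
  move=> _ [y + <-]; rewrite VU => -[y1 _].
  by rewrite (le_trans (ler_normB _ _))// -[2]/(1 + 1) lerD.
have [||| ub lub] := @supremum_lub _ supK [set `|x - y| | y in V].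
- by exists `|x - x|, x.
- by move=> _ [y _ <-].
- by exists 2.
apply/eqP; rewrite eq_le lub//=; apply/ler_addgt0Pr => e e0.
have q0 : 0 < 4^-1 :> K by rewrite invr_gt0.
have e1 : 0 < 4 * (1 + e) by rewrite mulr_gt0// addr_gt0.
(* t is at most 1/4, to stay in V, and at most e / 2, for the distance. *)
pose t := e / (4 * (1 + e)).
have t0 : 0 < t by rewrite divr_gt0.
have t4 : t <= 4^-1.
  by rewrite ler_pdivrMr// mulKf ?pnatr_eq0// lerDr.
have te : t + t <= e.
  rewrite -subr_ge0.
  have -> : e - (t + t) = (e * (1 + 2 * e)) / (2 * (1 + e)).
    by rewrite /t; field; rewrite gt_eqF// addr_gt0.
  by rewrite divr_ge0 ?mulr_ge0 ?addr_ge0 ?mulr_ge0// ltW.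
have [b [Ab bs bx]] : exists b, [/\ A b, ~ large_classes A s 4^-1 (sphere_pi b)
    & 1 - t < `|(\val b : topdual X) x|].
  apply: (limit_class_near supK _ _ _ al); last exact: finite_large_classes.
    by rewrite subr_ge0 (le_trans t4)// invf_le1// ler1n.
  by rewrite ax gtrBl.
have small := notin_large_classes q0 Ab bs.
have bP := coordinateP supK (AL b Ab); have b1 := sphere_norm b.
have [p p1 pb] := phase ((\val b : topdual X) x).
have p0 : p != 0 by rewrite -normr_eq0 p1 oner_eq0.
(* Since p (b x) = |b x|, this is the unimodular scalar opposite to b x. *)
pose lam := - p^-1.
have lam1 : `|lam| <= 1 by rewrite normrN normfV p1 invr1.
have [y [y1 by_ ys]] := L_coordinate_prescribe supK hbK b1 bP x1 lam1 t0 small.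
have Vy : V y.
  rewrite VU; split=> //; apply: sU => f fs.
  apply: le_lt_trans (ys f fs) _.
  apply: (@le_lt_trans _ _ (4^-1 * 2 + 4^-1)); first by rewrite lerD2l.
  rewrite -subr_gt0 (_ : _ - _ = 4^-1)//; by field.
have far : 1 + `|(\val b : topdual X) x| = `|(\val b : topdual X) x - lam|.
  have -> : (\val b : topdual X) x - lam =
      p^-1 * (1 + `|(\val b : topdual X) x|).
    by rewrite /lam -pb; field.
  by rewrite normrM normfV p1 invr1 mul1r ger0_norm// addr_ge0.
apply: (@le_trans _ _ (`|x - y| + (t + t))); last first.
  by apply: lerD te; apply: ub; exists y.
apply: (@le_trans _ _ (1 + `|(\val b : topdual X) x| + t)).
  have -> : (2 : K) = 1 + (1 - t) + t by ring.
  by rewrite lerD2r lerD2l ltW.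
rewrite addrA lerD2r far.
have -> : (\val b : topdual X) x - lam =
  (\val b : topdual X) (x - y) + ((\val b : topdual X) y - lam).
  by rewrite dual_funB; ring.
apply: le_trans (ler_normD _ _) _; apply: lerD => //.
by apply: le_trans (le_dual_norm supK _ _) _; rewrite b1 mul1r.
Qed.

Lemma weak_DD2P_of_infinite_cluster (A : set (dual_sphere X)) :
  norming_l1_structure A ->
  infinite_set (limit_point (sphere_pi @` A) `&` (sphere_pi @` A)) ->
  weak_DD2P X.
Proof.
move=> [_ AL] inf _ [U Uo ->] [x0 [x01 Ux0]].
have [a [x [al x1 Ux ax]]] := attaining_point_in_weak_open AL inf Uo x01 Ux0.
by exists x => // V Vo Vx; exact: supremum_dist_attaining AL al x1 ax Vo Vx.
Qed.

End WeakDD2P.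

(* The first conjunct is the case of real scalars, the second one that of
   complex scalars. *)
Theorem theorem2p7 (R : realType) :
  (forall (X : completeNormedModType R) (A : set (dual_sphere X)),
     norming_l1_structure A ->
     infinite_set (limit_point (sphere_pi @` A) `&` (sphere_pi @` A)) ->
     weak_DD2P X) /\
  (forall (X : completeNormedModType R[i]) (A : set (dual_sphere X)),
     norming_l1_structure A ->
     infinite_set (limit_point (sphere_pi @` A) `&` (sphere_pi @` A)) ->
     weak_DD2P X).
Proof.
split=> X A.
  apply: weak_DD2P_of_infinite_cluster; first exact: real_sup_complete.
  exact: real_hahn_banach_separation.
apply: weak_DD2P_of_infinite_cluster; first exact: complex_sup_complete.
exact: complex_hahn_banach_separation.
Qed.
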